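(* Let $M$ be a paving matroid of rank $r$ on ground set $[n]$, let $\mathcal{H}$ be its set of hyperplanes, and for $r\le s\le n-1$ let $\mathcal{H}_s=\{H\in\mathcal{H}: |H|=s\}$. Then for every nonnegative integer $t$, \[ \mathrm{ehr}_{M}(t)=\mathrm{ehr}_{U_{r,n}}(t)-\sum_{s=r}^{n-1}|\mathcal{H}_s|\sum_{m=0}^{t-1}\sum_{i=0}^{s-r}(-1)^i\binom{s}{i}\binom{t(s-r-i)+m+s-1-i}{s-1}\binom{m+n-s-1}{m}. \]
   Context: A matroid of rank $r$ is paving if every circuit has cardinality at least $r$. A hyperplane is a flat of rank $r-1$. $U_{r,n}$ is the uniform matroid on $[n]$ whose bases are all $r$-subsets. The base polytope of $M$ on $[n]$ is $\mathcal{P}_M=\mathrm{conv}\{\sum_{i\in B}\mathbf{e}_i: B\text{ a basis}\}\subset\mathbb{R}^n$ and $\mathrm{ehr}_M(t)=|t\mathcal{P}_M\cap\mathbb{Z}^n|$ for nonnegative integers $t$. *)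

(* Defs.v *)
From HB Require Import structures.
From mathcomp Require Import all_boot all_order all_algebra.

Set Implicit Arguments.
Unset Strict Implicit.
Unset Printing Implicit Defensive.

Import Order.TTheory GRing.Theory Num.Theory.

Record matroid (T : finType) := Matroid {
  indep : {set {set T}};
  indep0 : set0 \in indep;
  indepS : forall I J : {set T}, J \in indep -> I \subset J -> I \in indep;
  indep_aug : forall I J : {set T}, I \in indep -> J \in indep -> #|I| < #|J| ->
    exists2 e, e \in J :\: I & e |: I \in indep }.

Section MatroidNotions.
Context {T : finType}.
Variable M : matroid T.

Definition bases : {set {set T}} :=
  [set B | maxset (fun X : {set T} => X \in indep M) B].

Definition circuits : {set {set T}} :=
  [set C | minset (fun X : {set T} => X \notin indep M) C].

Definition rk (A : {set T}) : nat := \max_(I in indep M | I \subset A) #|I|.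

Definition mrank : nat := rk [set: T].

Definition flats : {set {set T}} :=
  [set F : {set T} | [forall (e | e \notin F), rk F < rk (e |: F)]].

(* [(rk H).+1 == mrank] rather than [rk H == mrank.-1]: with truncated
   predecessor a matroid of rank 0 would wrongly acquire a hyperplane. *)
Definition hyperplanes : {set {set T}} :=
  [set H : {set T} in flats | (rk H).+1 == mrank].

Definition hyperplanes_of_card (s : nat) : {set {set T}} :=
  [set H : {set T} in hyperplanes | #|H| == s].

Definition paving : Prop := forall C, C \in circuits -> mrank <= #|C|.

End MatroidNotions.

Section Uniform.
Variables r n : nat.

Let uindep : {set {set 'I_n}} := [set I : {set 'I_n} | #|I| <= r].

Fact uniform_indep0 : set0 \in uindep.
Proof. by rewrite inE cards0. Qed.

Fact uniform_indepS (I J : {set 'I_n}) :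
  J \in uindep -> I \subset J -> I \in uindep.
Proof. by rewrite !inE => hJ /subset_leq_card; move/leq_trans; apply. Qed.

Fact uniform_indep_aug (I J : {set 'I_n}) :
  I \in uindep -> J \in uindep -> #|I| < #|J| ->
  exists2 e, e \in J :\: I & e |: I \in uindep.
Proof.
rewrite !inE => _ hJ hIJ.
have /subsetPn[e eJ eI] : ~~ (J \subset I).
  by apply/negP => /subset_leq_card; rewrite leqNgt hIJ.
exists e; first by rewrite inE eI.
by rewrite inE cardsU1 eI; apply: leq_trans hIJ hJ.
Qed.

Definition uniform : matroid 'I_n :=
  Matroid uniform_indep0 uniform_indepS uniform_indep_aug.

Lemma bases_uniform : r <= n -> bases uniform = [set B : {set 'I_n} | #|B| == r].
Proof.
move=> rn; apply/setP => B; rewrite !inE; apply/maxsetP/eqP => [[]|hB].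
  rewrite inE leq_eqVlt => /orP[/eqP //|ltBr] maxB.
  have /subsetPn[e _ eB] : ~~ ([set: 'I_n] \subset B).
    apply/negP => /subset_leq_card; rewrite cardsT card_ord leqNgt.
    by rewrite (leq_trans ltBr rn).
  have := maxB (e |: B); rewrite inE cardsU1 eB ltBr => /(_ isT (subsetUr _ _)).
  by move=> eqB; move: eB; rewrite -eqB setU11.
split=> [|A]; first by rewrite inE hB.
by rewrite inE -hB => cA sBA; apply/eqP; rewrite eq_sym eqEcard sBA cA.
Qed.

End Uniform.

From mathcomp Require Import finmap all_classical.
From mathcomp Require Import reals.

Local Open Scope classical_set_scope.
Local Open Scope ring_scope.

Definition convex_hull (R : realType) (V : lmodType R) (S : set V) : set V :=
  [set x | exists k (a : 'I_k -> R) (v : 'I_k -> V),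
     [/\ forall i, 0 <= a i, \sum_i a i = 1, forall i, S (v i) &
         x = \sum_i a i *: v i]].

Section Ehrhart.
Variables (R : realType) (n : nat).
Implicit Types (M : matroid 'I_n) (t : nat).

Definition base_polytope M : set 'rV[R]_n :=
  convex_hull [set \sum_(i in B) delta_mx 0 i | B in [set` bases M]].

Definition dilated_lattice_points M t : set 'rV[int]_n :=
  [set z | [set t%:R *: x | x in base_polytope M] (map_mx intr z)].

(* Guarantees that the default value of [fset_set] on infinite sets plays no
   role in [ehr]. *)
Lemma finite_dilated_lattice_points M t :
  finite_set (dilated_lattice_points M t).
Proof.
pose f (g : {ffun 'I_n -> 'I_t.+1}) : 'rV[int]_n := \row_j (val (g j))%:Z.
apply: (@sub_finite_set _ _ (f @` setT)); last exact/finite_image/finite_finset.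
move=> z [x [k [a [v [a0 a1 vB ->]]]]] eqz.
have vE i j : 0 <= v i 0 j <= 1.
  have [B _ <-] := vB i; rewrite summxE.
  under eq_bigr do rewrite mxE eqxx /=.
  case: (boolP (j \in B)) => jB.
    rewrite (bigD1 j) //= eqxx big1 ?addr0 ?ler01 ?lexx // => l /andP[_ ne].
    by rewrite eq_sym (negPf ne).
  rewrite big1 ?lexx ?ler01 // => l lB.
  by case: eqP => // jl; rewrite jl lB in jB.
have zE j : 0 <= z 0 j <= t%:Z.
  rewrite -!(ler_int R).
  have -> : (z 0 j)%:~R = t%:R * \sum_i a i * v i 0 j :> R.
    have := congr1 (fun m : 'rV[R]_n => m 0 j) eqz; rewrite !mxE => <-.
    by rewrite summxE; congr (_ * _); apply: eq_bigr => i _; rewrite mxE.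
  apply/andP; split.
    rewrite mulr_ge0 ?ler0n // sumr_ge0 // => i _.
    by have /andP[v0 _] := vE i j; rewrite mulr_ge0.
  rewrite -[leRHS]mulr1 ler_wpM2l ?ler0n // -[leRHS]a1 ler_sum // => i _.
  by have /andP[_ v1] := vE i j; rewrite ler_piMr.
exists [ffun j => inord (absz (z 0 j))] => //.
apply/rowP => j; rewrite mxE ffunE /=; have /andP[z0 zt] := zE j.
by rewrite inordK ?gez0_abs // ltnS -lez_nat gez0_abs.
Qed.

Definition ehr M t : nat := #|` fset_set (dilated_lattice_points M t)|%fset.

End Ehrhart.

(* Main.v *)
(** A lattice point [z] of the scaled uniform polytope ([0 <= z <= t],
    [z(E) = rt]) lies in [t P_M] iff [z(H) <= t (r-1)] for every hyperplane
    [H].  Two distinct hyperplanes of a paving matroid meet in at most [r-2]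
    elements, so [z(H) + z(H') <= rt + t(r-2)] and at most one hyperplane can be
    violated by [z].  If [|H| = s], the violating points split as a point of
    [[0,t]^H] of sum [rt - m] times a point of [N^(E\H)] of sum [m < t]; after
    the reflection [z |-> t - z] on [H], both are counted by coefficients of
    powers of [1 + X + ... + X^t].

    The inequality description is proved by decomposing a point of the cone
    over it as a nonnegative combination of bases: subtract the largest feasible
    multiple of a basis satisfying with equality every inequality that is tight
    at the point, and induct on the number of non-tight inequalities. *)

Require Import Defs.
From mathcomp Require Import finmap all_classical.
From mathcomp Require Import all_boot all_order all_algebra.
From mathcomp Require Import reals.
From mathcomp Require Import ring lra zify.

Set Implicit Arguments.
Unset Strict Implicit.
Unset Printing Implicit Defensive.

Import Order.TTheory GRing.Theory Num.Theory.

(** * Rank, bases and hyperplanes of a matroid *)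

Section MatroidRank.
Context {T : finType}.
Variable M : matroid T.
Implicit Types (A B H I J : {set T}) (e : T).

Lemma leq_rk_card A : rk M A <= #|A|.
Proof. by apply/bigmax_leqP => I /andP[_ /subset_leq_card]. Qed.

Lemma indep_leq_rk I A : I \in indep M -> I \subset A -> #|I| <= rk M A.
Proof. by move=> iI sIA; apply: leq_bigmax_cond; rewrite iI. Qed.

Lemma rkS A B : A \subset B -> rk M A <= rk M B.
Proof.
move=> sAB; apply/bigmax_leqP => I /andP[iI sIA].
exact/indep_leq_rk/(subset_trans sIA).
Qed.

(** Augmenting [I] from a largest independent subset [K] of [A] stays inside [A] and stops only at
    size [rk M A]. *)
Lemma indep_extend I A : I \in indep M -> I \subset A ->
  exists J, [/\ J \in indep M, I \subset J, J \subset A & #|J| = rk M A].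
Proof.
have [K [iK sKA cK]] : exists K, [/\ K \in indep M, K \subset A & #|K| = rk M A].
  have : 0 < #|[pred X : {set T} | (X \in indep M) && (X \subset A)]|.
    by apply/card_gt0P; exists set0; rewrite inE indep0 sub0set.
  case/(eq_bigmax_cond (fun X : {set T} => #|X|)) => K /andP[iK sKA] eK.
  by exists K; split.
elim: {I}_.+1 {-2}I (ltnSn (rk M A - #|I|)) => // d IHd I led iI sIA.
have [leK|ltI] := leqP (rk M A) #|I|.
  by exists I; split=> //; apply/eqP; rewrite eqn_leq leK indep_leq_rk.
have [|e] := indep_aug iI iK; first by rewrite cK.
rewrite inE => /andP[eI eK] ieI.
have cU : #|e |: I| = #|I|.+1 by rewrite cardsU1 eI.
have [||J [iJ sJ sJA cJ]] := IHd (e |: I) _ ieI.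
- by rewrite cU; move: led; rewrite ltnS; apply: leq_trans; rewrite ltn_sub2l.
- by rewrite subUset sub1set sIA (subsetP sKA).
by exists J; split=> //; apply: subset_trans sJ; exact: subsetUr.
Qed.

Lemma rk_setU1 e A : rk M (e |: A) <= (rk M A).+1.
Proof.
apply/bigmax_leqP => I /andP[iI sIA].
have : #|I :\ e| <= rk M A.
  by apply: indep_leq_rk; [apply: indepS iI _; exact: subD1set|rewrite subDset].
by rewrite (cardsD1 e I) => h; apply: leq_trans (leq_add (leq_b1 _) h) _.
Qed.

Lemma basesE B : (B \in bases M) = (B \in indep M) && (#|B| == mrank M).
Proof.
rewrite inE; apply/maxsetP/andP => -[iB].
  move=> maxB; split=> //.
  have [J [iJ sBJ _ cJ]] := indep_extend iB (subsetT B).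
  by rewrite -(maxB J) ?cJ.
move=> /eqP cB; split=> // X iX sBX; apply/eqP; rewrite eq_sym eqEcard sBX cB.
exact/indep_leq_rk/subsetT.
Qed.

Lemma bases_neq0 : exists B, B \in bases M.
Proof.
have [J [iJ _ _ cJ]] := indep_extend (indep0 M) (sub0set [set: T]).
by exists J; rewrite basesE iJ cJ /=.
Qed.

Lemma hyperplane_rk H : H \in hyperplanes M -> (rk M H).+1 = mrank M.
Proof. by rewrite inE => /andP[_ /eqP]. Qed.

Lemma hyperplane_proper H : H \in hyperplanes M -> H \proper [set: T].
Proof.
move=> hH; rewrite properE subsetT; apply/negP => /rkS.
by rewrite leqNgt -/(mrank M) -(hyperplane_rk hH) ltnSn.
Qed.

Lemma hyperplane_ltn_rkU1 H e : H \in hyperplanes M -> e \notin H ->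
  rk M H < rk M (e |: H).
Proof. by rewrite !inE => /andP[/forall_inP h _]; exact: h. Qed.

(** A maximal set of deficient rank is a flat; its rank is one less than full, since one more
    element raises it by at most one. *)
Lemma sub_hyperplane A : rk M A < mrank M ->
  exists2 H, H \in hyperplanes M & A \subset H.
Proof.
move=> /(maxset_exists (P := fun X => rk M X < mrank M))[H /maxsetP[rH maxH] sAH].
exists H => //; have hH e : e \notin H -> rk M H < rk M (e |: H).
  move=> eH; apply: leq_trans rH _; rewrite leqNgt; apply/negP => h.
  by have := maxH _ h (subsetUr _ _) => /setP/(_ e); rewrite !inE eqxx (negPf eH).
rewrite inE; apply/andP; split; first by rewrite inE; apply/forall_inP.
rewrite eqn_leq rH /=.
have /subsetPn[e _ eH] : ~~ ([set: T] \subset H).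
  by apply/negP => /rkS; rewrite leqNgt rH.
apply: leq_trans (rk_setU1 e H); rewrite leqNgt; apply/negP => h.
by have := maxH _ h (subsetUr _ _) => /setP/(_ e); rewrite !inE eqxx (negPf eH).
Qed.

(** [I] already has the rank of [H], so an element augmenting it inside [e |: H] cannot lie in [H]
    and must be [e]. *)
Lemma hyperplane_setU1_indep H I e : H \in hyperplanes M ->
  I \in indep M -> I \subset H -> #|I|.+1 = mrank M -> e \notin H ->
  e |: I \in indep M.
Proof.
move=> hH iI sIH cI eH; have rI : #|I| = rk M H.
  by apply: succn_inj; rewrite cI hyperplane_rk.
have [J [iJ _ sJ cJ]] := indep_extend (indep0 M) (sub0set (e |: H)).
have [|f] := indep_aug iI iJ; first by rewrite cJ rI hyperplane_ltn_rkU1.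
rewrite inE => /andP[fI /(subsetP sJ)]; rewrite !inE.
move=> /orP[/eqP->//|fH] ifI.
have : #|f |: I| <= rk M H by rewrite indep_leq_rk // subUset sub1set fH.
by rewrite cardsU1 fI rI ltnn.
Qed.

(** * Independence and hyperplane intersections in paving matroids *)

Hypothesis pavM : paving M.

Lemma paving_indep I : #|I| < mrank M -> I \in indep M.
Proof.
move=> cI; apply: contraLR cI => nI; rewrite -leqNgt.
have [C mC sCI] := minset_exists (P := fun X => X \notin indep M) nI.
by apply: leq_trans (subset_leq_card sCI); apply: pavM; rewrite inE.
Qed.

Lemma paving_leq_rk k A : k < mrank M -> k <= #|A| -> k <= rk M A.
Proof.
move=> kr kA; rewrite leqNgt; apply/negP => rk_lt.
have [I [iI _ sIA cI]] := indep_extend (indep0 M) (sub0set A).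
have /subsetPn[e eA eI] : ~~ (A \subset I).
  by apply/negP => /subset_leq_card; rewrite cI leqNgt (leq_trans rk_lt).
have cU : #|e |: I| = (rk M A).+1 by rewrite cardsU1 eI cI.
have ieI : e |: I \in indep M by rewrite paving_indep // cU (leq_ltn_trans _ kr).
have : #|e |: I| <= rk M A by rewrite indep_leq_rk // subUset sub1set eA.
by rewrite cU ltnn.
Qed.

(** A larger intersection would contain an independent set of the rank of [H]; adding to it an
    element of [H'] outside [H] would give an independent subset of [H'] exceeding its rank. *)
Lemma paving_card_hyperplaneI H H' : H \in hyperplanes M ->
  H' \in hyperplanes M -> H != H' -> #|H :&: H'|.+2 <= mrank M.
Proof.
wlog /subsetPn[e eH' eH] : H H' / ~~ (H' \subset H).
  move=> hw hH hH' ne; have [sH'|] := boolP (H' \subset H); last first.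
    by move=> nsub; apply: hw.
  rewrite setIC; apply: hw => //; last by rewrite eq_sym.
  by apply: contra ne => sH; rewrite eqEsubset sH.
move=> hH hH' _; rewrite ltnNge -(hyperplane_rk hH) ltnS; apply/negP => le.
have [I [iI _ sI cI]] := indep_extend (indep0 M) (sub0set (H :&: H')).
move: sI; rewrite subsetI => /andP[sIH sIH'].
have {}cI : #|I| = rk M H.
  apply/eqP; rewrite eqn_leq indep_leq_rk //= cI paving_leq_rk //.
  by rewrite -(hyperplane_rk hH).
have cI1 : #|I|.+1 = mrank M by rewrite cI hyperplane_rk.
have := hyperplane_setU1_indep hH iI sIH cI1 eH.
move=> /indep_leq_rk-/(_ H'); rewrite subUset sub1set eH' sIH' => /(_ isT).
rewrite cardsU1 (contra (subsetP sIH e) eH) add1n cI1 -(hyperplane_rk hH').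
by rewrite ltnn.
Qed.

End MatroidRank.

Local Open Scope ring_scope.

Lemma natr_card_sum (F : realFieldType) (T : finType) (A B : {set T}) :
  \sum_(i in A) (i \in B)%:R = #|A :&: B|%:R :> F.
Proof.
rewrite -sum1_card natr_sum big_mkcond [RHS]big_mkcond; apply: eq_bigr => i _.
by rewrite inE; case: (i \in A); case: (i \in B).
Qed.

(** * The cone over the base polytope and its inequalities *)

Section BasisCone.
Context {F : realFieldType} {T : finType}.
Variable M : matroid T.
Implicit Types (A B H : {set T}) (x y : T -> F) (t s : F).
Local Notation r := (mrank M).

(* Slacks, homogenized by [t], of the inequalities defining the polytope; the
   index is [None] for [t >= 0]. *)
Definition slack (k : option (T + T + {set T})) x t : F :=
  match k with
  | None => t
  | Some (inl (inl j)) => x j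
  | Some (inl (inr j)) => t - x j
  | Some (inr H) =>
      if H \in hyperplanes M then t * r.-1%:R - \sum_(i in H) x i else 0
  end.

(** Keeping the height [t] variable allows a multiple of a basis to be subtracted within one and the
    same cone. *)
Definition basis_cone x t : Prop :=
  \sum_i x i = t * r%:R /\ forall k, 0 <= slack k x t.

Definition indicator B : T -> F := fun i => (i \in B)%:R.

Lemma slack_subZ k x y t s (l : F) :
  slack k (fun i => x i - l * y i) (t - l * s) = slack k x t - l * slack k y s.
Proof.
case: k => [[[j|j]|H]|] //=; first by ring.
case: ifP => _; last by ring.
by rewrite sumrB -mulr_sumr; ring.
Qed.

Lemma slack_sum (I : finType) (P : pred I) k (a : I -> F) (x : I -> T -> F) t :
  slack k (fun i => \sum_(l | P l) a l * x l i) (\sum_(l | P l) a l * t) =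
  \sum_(l | P l) a l * slack k (x l) t.
Proof.
case: k => [[[j|j]|H]|] //=.
  by rewrite -sumrB; apply: eq_bigr => l _; rewrite mulrBr.
case: ifP => _; last by rewrite big1 // => l _; rewrite mulr0.
rewrite exchange_big mulr_suml -sumrB; apply: eq_bigr => l _.
by rewrite -mulr_sumr mulrBr mulrA.
Qed.

Lemma card_basisI_hyperplane B H : B \in bases M -> H \in hyperplanes M ->
  (#|B :&: H| <= r.-1)%N.
Proof.
rewrite basesE => /andP[iB _] hH.
rewrite -(hyperplane_rk hH) /=; apply: indep_leq_rk; last exact: subsetIr.
exact/(indepS iB)/subsetIl.
Qed.

Lemma basis_in_cone B : B \in bases M -> basis_cone (indicator B) 1.
Proof.
move=> bB; split.
  rewrite mul1r -(eq_bigl _ _ (@in_setT T)) natr_card_sum setTI.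
  by move: bB; rewrite basesE => /andP[_ /eqP->].
case=> [[[j|j]|H]|] /=; rewrite ?ler01 ?ler0n //.
  by rewrite subr_ge0 /indicator lern1 leq_b1.
case: ifP => // hH; rewrite mul1r natr_card_sum subr_ge0 ler_nat setIC.
exact: card_basisI_hyperplane.
Qed.

Lemma basis_cone_sum (I : finType) (P : pred I) (a : I -> F) (B : I -> {set T}) :
  (forall l, P l -> 0 <= a l) -> (forall l, P l -> B l \in bases M) ->
  basis_cone (fun i => \sum_(l | P l) a l * indicator (B l) i) (\sum_(l | P l) a l).
Proof.
move=> a0 bB; split.
  rewrite exchange_big mulr_suml; apply: eq_bigr => l Pl.
  have [sB _] := basis_in_cone (bB l Pl).
  by rewrite -mulr_sumr sB mul1r.
move=> k; have := slack_sum P k a (fun l => indicator (B l)) 1.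
under eq_bigr do rewrite mulr1.
move=> ->; apply: sumr_ge0 => l Pl; rewrite mulr_ge0 ?a0 //.
by have [_] := basis_in_cone (bB l Pl).
Qed.

(** Knowing the sum on [A] thus bounds how many elements of [A] reach [t], and how many lie in the
    support. *)
Lemma cone_card_level x t A : 0 <= t -> (forall i, 0 <= x i <= t) ->
  t * #|[set i | x i == t] :&: A|%:R <= \sum_(i in A) x i
    <= t * #|[set i | x i != 0] :&: A|%:R.
Proof.
move=> t0 xt; rewrite ![_ :&: A]setIC -!natr_card_sum !mulr_sumr.
apply/andP; split; apply: ler_sum => i _; have /andP[x0 lext] := xt i.
  by rewrite inE; case: eqP => [->|_]; rewrite ?mulr1 ?mulr0.
by rewrite inE; case: eqP => [->|_]; rewrite ?mulr1 ?mulr0.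
Qed.

Hypothesis pavM : paving M.

(** The basis consists of [r - 1] elements of [H] and one outside; it contains all elements of value
    [t] and lies in the support. Any other tight hyperplane is then met in [r - 1] elements as
    well. *)
Lemma basis_of_face_tight x t H : basis_cone x t -> 0 < t ->
  H \in hyperplanes M -> slack (Some (inr H)) x t = 0 ->
  exists2 B, B \in bases M &
    forall k, slack k x t = 0 -> slack k (indicator B) 1 = 0.
Proof.
move=> [sx slx] t0 hH; rewrite /= hH => /eqP; rewrite subr_eq0 => /eqP xH.
have xt i : 0 <= x i <= t.
  rewrite (slx (Some (inl (inl i)))) /=.
  by have := slx (Some (inl (inr i))); rewrite /= subr_ge0.
have level := cone_card_level _ (ltW t0) xt.
set U := [set i | x i == t] in level; set S := [set i | x i != 0] in level.
have sUS : U \subset S.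
  by apply/subsetP => i; rewrite !inE => /eqP->; rewrite gt_eqF.
have r_gt0 : (0 < r)%N by rewrite -(hyperplane_rk hH).
have rE : r%:R = r.-1%:R + 1 :> F by rewrite natr1 prednK.
have [cUH cSH] : (#|U :&: H| <= r.-1 /\ r.-1 <= #|S :&: H|)%N.
  have := level H; rewrite -xH !ler_pM2l // !ler_nat.
  by case/andP.
have xC : \sum_(i in ~: H) x i = t.
  move: sx; rewrite (bigID (mem H)) /= -xH rE mulrDr mulr1 => /addrI <-.
  by apply: eq_bigl => i; rewrite inE.
(* Off [H] the sum is exactly [t], so at most one element there has value [t] and at least one is in
   the support. *)
have [cUC cSC] : (#|U :&: ~: H| <= 1 /\ 0 < #|S :&: ~: H|)%N.
  have := level (~: H); rewrite xC -{2 3}[t]mulr1 !ler_pM2l // lern1 ler1n.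
  by case/andP.
(* Paving makes [U :&: H] independent, as it has fewer than [r] elements, and gives [S :&: H] rank
   [r - 1]. *)
have [J [iJ sUJ sJ cJ]] : exists J, [/\ J \in indep M, U :&: H \subset J,
    J \subset S :&: H & #|J| = rk M (S :&: H)].
  apply: indep_extend; last exact: setSI.
  by apply: paving_indep => //; rewrite (leq_ltn_trans cUH) // prednK.
have {}cJ : #|J| = r.-1.
  apply/eqP; rewrite cJ eqn_leq paving_leq_rk ?prednK // andbT.
  by rewrite -(hyperplane_rk hH) rkS // subsetIr.
move: sJ; rewrite subsetI => /andP[sJS sJH].
(* An element of value [t] off [H] must be chosen if there is one; otherwise any support element off
   [H] works. *)
have [e [eS eH Ue]] : exists e, [/\ e \in S, e \notin H &
    forall f, f \in U -> f \notin H -> f = e].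
  have [U0|[e eUC]] := set_0Vmem (U :&: ~: H); last first.
    exists e; move: (eUC); rewrite !inE => /andP[/eqP ee eH].
    split=> //; first by rewrite ee gt_eqF.
    move=> f fU fH; apply: (card_le1_eqP cUC) => //.
    by rewrite in_setI fU inE.
  case/card_gt0P: cSC => e; rewrite inE => /andP[eS]; rewrite inE => eH.
  exists e; split=> // f fU fH.
  by have := in_set0 f; rewrite -U0 in_setI fU inE fH.
have eJ : e \notin J by apply: contra eH; apply/subsetP.
have bB : e |: J \in bases M.
  rewrite basesE cardsU1 eJ cJ add1n prednK // eqxx andbT.
  by apply: (hyperplane_setU1_indep hH iJ sJH) => //; rewrite cJ prednK.
exists (e |: J) => // -[[[j|j]|H']|] /=; last by move=> t_eq0; rewrite t_eq0 ltxx in t0.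
- move=> xj; rewrite /indicator; case: setU1P => // -[je|jJ].
    by move: eS; rewrite -je inE xj eqxx.
  by move: (subsetP sJS _ jJ); rewrite inE xj eqxx.
- move=> /eqP; rewrite subr_eq0 eq_sym => xj; rewrite /indicator.
  suff -> : j \in e |: J by rewrite subrr.
  have jU : j \in U by rewrite inE.
  have [jH|jH] := boolP (j \in H); last by rewrite (Ue j) ?setU11.
  by apply/setU1r/(subsetP sUJ); rewrite inE jU.
case: ifP => // hH' /eqP; rewrite subr_eq0 mul1r natr_card_sum setIC => /eqP xH'.
apply/eqP; rewrite subr_eq0 eqr_nat eqn_leq card_basisI_hyperplane // andbT.
have [<-|neH] := eqVneq H H'.
  rewrite -cJ; apply/subset_leq_card/subsetP => j jJ.
  by rewrite inE setU1r //= (subsetP sJH).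
have cK := paving_card_hyperplaneI pavM hH hH' neH.
set K := H :&: H' in cK.
(* [x(H) + x(H') = 2t(r-1)] forces [x = t] on [H :&: H'] and [x = 0] off
   [H :|: H'], hence [e] lies in [H'] and [H :&: H'] in [J]. *)
have xD : \sum_(i in H' :\: H) x i + \sum_(i in ~: (H :|: H')) x i = t.
  rewrite -xC [RHS](big_setID H') /=; congr (_ + _); apply: eq_bigl => j.
    by rewrite !inE andbC.
  by rewrite !inE negb_or andbC.
have xK : \sum_(i in K) x i + \sum_(i in H' :\: H) x i = t * r.-1%:R.
  by rewrite xH' [RHS](big_setID H) /= setIC.
have cKF : #|K|%:R + 1 <= r.-1%:R :> F.
  by rewrite natr1 ler_nat -ltnS prednK.
have ge0 A : 0 <= \sum_(i in A) x i.
  by apply: sumr_ge0 => i _; have /andP[] := xt i.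
have xK_le : \sum_(i in K) x i <= t * #|K|%:R.
  rewrite mulr_natr -sumr_const; apply: ler_sum => i _.
  by have /andP[] := xt i.
have tcK : t * #|K|%:R + t <= t * r.-1%:R.
  by rewrite -[X in _ + X]mulr1 -mulrDr ler_pM2l.
have := ge0 (~: (H :|: H')); have := ge0 (H' :\: H) => ge1 ge2.
have xN : \sum_(i in ~: (H :|: H')) x i = 0 by lra.
have xKE : \sum_(i in K) x i = t * #|K|%:R by lra.
have cKE : #|K|.+1 = r.-1.
  apply/eqP; rewrite -(eqr_nat F) -natr1.
  have := mulfI (lt0r_neq0 t0); move=> /(_ (#|K|%:R + 1) r.-1%:R) -> //.
  by rewrite mulrDr mulr1; lra.
have sKU : K \subset U.
  apply/subsetP => i iK; rewrite inE eq_sym -subr_eq0; apply/eqP.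
  apply: (psumr_eq0P (P := mem K) (F := fun i => t - x i)) => // [l _|].
    by rewrite subr_ge0; have /andP[] := xt l.
  by rewrite sumrB sumr_const xKE mulr_natr subrr.
have eH' : e \in H'.
  move: eS; rewrite inE; apply: contraR => eH'; apply/eqP.
  apply: (psumr_eq0P _ xN); first by move=> i _; have /andP[] := xt i.
  by rewrite !inE negb_or eH eH'.
have eK : e \notin K by rewrite inE (negPf eH).
(* [e |: K] has [r.-1] elements and lies in both the basis and [H']. Reading [true] as [e \notin K]
   gives the shape of [cardsU1]. *)
rewrite -cKE -[#|K|.+1]/(true + #|K|)%N -eK -cardsU1.
apply: subset_leq_card; rewrite subUset sub1set inE setU11 eH' /=.
apply/subsetP => i iK; have := iK; rewrite inE => /andP[iH iH'].
rewrite inE iH' andbT setU1r // (subsetP sUJ) // inE iH andbT.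
exact: (subsetP sKU).
Qed.

(** With no tight hyperplane, any basis between the set [U] of elements of value [t] and the support
    [S] works; it exists because [U] is independent and [S] has full rank. *)
Lemma basis_of_face x t : basis_cone x t -> 0 < t ->
  exists2 B, B \in bases M &
    forall k, slack k x t = 0 -> slack k (indicator B) 1 = 0.
Proof.
move=> cx t0.
have [/exists_inP[H hH /eqP]|/exists_inPn no_tight] :=
  boolP [exists H in hyperplanes M, slack (Some (inr H)) x t == 0].
  exact: basis_of_face_tight.
have [sx slx] := cx.
have xt i : 0 <= x i <= t.
  rewrite (slx (Some (inl (inl i)))) /=.
  by have := slx (Some (inl (inr i))); rewrite /= subr_ge0.
have level := cone_card_level [set: T] (ltW t0) xt.
move: level; rewrite !setIT.
set U := [set i | x i == t]; set S := [set i | x i != 0] => /andP[leU leS].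
have sumT : \sum_(i in [set: T]) x i = t * r%:R.
  by rewrite -sx; apply: eq_bigl => i; rewrite inE.
have sUS : U \subset S.
  by apply/subsetP => i; rewrite !inE => /eqP->; rewrite gt_eqF.
have cU : (#|U| <= r)%N by move: leU; rewrite sumT ler_pM2l // ler_nat.
have sumS A : S \subset A -> \sum_(i in A) x i = t * r%:R.
  move=> sSA; rewrite -sx big_mkcond; apply: eq_bigr => i _.
  case: ifP => // /negbT iA; apply/esym/eqP; apply: contraR iA => xi.
  by apply: (subsetP sSA); rewrite inE.
(* A support of smaller rank would lie in a hyperplane, which would carry the whole sum [t r], more
   than [t (r - 1)]. *)
have rS : rk M S = r.
  apply/eqP; rewrite eqn_leq; apply/andP; split; first exact/rkS/subsetT.
  rewrite leqNgt; apply/negP => /sub_hyperplane[H hH sSH].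
  have := slx (Some (inr H)); rewrite /= hH sumS // subr_ge0 ler_pM2l // ler_nat.
  by rewrite -(hyperplane_rk hH) /= ltnn.
(* Paving settles [#|U| < r]. If [#|U| = r], then [U] uses up the whole sum, so [S] equals [U] and
   its full rank gives independence. *)
have iU : U \in indep M.
  move: cU; rewrite leq_eqVlt => /orP[/eqP cU|]; last exact: paving_indep.
  have sSU : S \subset U.
    apply/subsetP => i; rewrite !inE; apply: contraR => iU.
    pose y j := x j - t * (j \in U)%:R.
    have y0 j : 0 <= y j.
      rewrite subr_ge0 inE; case: eqP => [->|_]; first by rewrite mulr1.
      by rewrite mulr0; have /andP[] := xt j.
    have yi : y i = 0.
      apply: (psumr_eq0P (P := mem [set: T]) (F := y)) => //; last exact: in_setT.
      by rewrite sumrB -mulr_sumr natr_card_sum setTI cU sumT subrr.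
    by move: yi; rewrite /y inE (negPf iU) mulr0 subr0 => ->.
  have [J [iJ _ sJ cJ]] := indep_extend (indep0 M) (sub0set S).
  suff -> : U = J by [].
  by apply/esym/eqP; rewrite eqEcard (subset_trans sJ sSU) cJ rS cU /=.
have [B [iB sUB sBS cB]] := indep_extend iU sUS.
exists B; first by rewrite basesE iB cB rS /=.
case=> [[[j|j]|H]|] /=; last by move=> t_eq0; rewrite t_eq0 ltxx in t0.
- move=> xj; rewrite /indicator; case: (boolP (j \in B)) => // jB.
  by move: (subsetP sBS _ jB); rewrite inE xj eqxx.
- move=> /eqP; rewrite subr_eq0 eq_sym => xj; rewrite /indicator.
  by rewrite (subsetP sUB) ?subrr // inE.
by case: ifP => // hH sl0; have := no_tight H hH; rewrite /= hH sl0 eqxx.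
Qed.

Lemma basis_coneP x t : basis_cone x t -> exists a : {set T} -> F,
  [/\ forall B, 0 <= a B, \sum_(B in bases M) a B = t &
      forall i, x i = \sum_(B in bases M) a B * indicator B i].
Proof.
elim: {x t}_.+1 {-2}x {-2}t (ltnSn #|[set k | slack k x t != 0]|) => // N IHN.
move=> x t ltN cx; have [sx slx] := cx.
(* Height [0] forces all coordinates to be [0], and the zero combination works. *)
have := slx None; rewrite /= le_eqVlt => /orP[/eqP t0|t0].
  exists (fun=> 0); split=> // [|i]; first by rewrite big1.
  rewrite big1 => [|B _]; last by rewrite mul0r.
  apply/eqP; rewrite eq_le (slx (Some (inl (inl i)))) andbT.
  by have := slx (Some (inl (inr i))); rewrite /= -t0 sub0r oppr_ge0.
have [B bB faceB] := basis_of_face cx t0.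
have [sB slB] := basis_in_cone bB.
pose v k := slack k (indicator B) 1.
pose P k := 0 < v k; pose q k := slack k x t / v k.
(* The height slack of a basis is [1], so the minimum below is over a nonempty set. *)
have PN : P None by rewrite /P /v /= ltr01.
(* The largest multiple of [B] that can be subtracted makes [k0] tight. *)
case: (Order.TotalTheory.arg_minP q PN) => k0 Pk0 mink0.
pose l := q k0.
have l_ge0 : 0 <= l by rewrite divr_ge0 // ltW.
pose x' i := x i - l * indicator B i.
have slE k : slack k x' (t - l) = slack k x t - l * v k.
  by rewrite -slack_subZ mulr1.
have cx' : basis_cone x' (t - l).
  split; first by rewrite sumrB -mulr_sumr sx sB mul1r mulrBl.
  move=> k; rewrite slE subr_ge0; have := slB k; rewrite le_eqVlt -/(v k).
  move=> /orP[/eqP <-|vk]; first by rewrite mulr0.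
  by rewrite -ler_pdivlMr //; exact: mink0.
(* Inequalities tight at [x] are tight at [B] and stay tight; [k0] is newly tight, since
   [v k0 > 0]. *)
have lt0 : (#|[set k | slack k x' (t - l) != 0%R]| < N)%N.
  rewrite ltnS in ltN; apply: leq_trans ltN; apply/proper_card/properP; split.
    apply/subsetP => k; rewrite !inE slE; apply: contraNneq => sl0.
    by rewrite sl0 /v faceB // mulr0 subrr.
  exists k0; rewrite !inE; last by rewrite slE /l /q divfK ?subrr ?eqxx ?lt0r_neq0.
  by apply: contraL Pk0 => /eqP sl0; rewrite /P /v faceB ?ltxx.
have [a [a0 a1 ax]] := IHN _ _ lt0 cx'.
exists (fun A => a A + (if A == B then l else 0)); split.
- by move=> A; rewrite addr_ge0 //; case: ifP.
- rewrite big_split /= a1 (bigD1 B) //= eqxx big1 ?addr0 ?subrK //.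
  by move=> A /andP[_ /negPf->].
move=> i; rewrite -(subrK (l * indicator B i) (x i)) -/(x' i) ax.
under [RHS]eq_bigr do rewrite mulrDl.
rewrite big_split /=; congr (_ + _).
rewrite (bigD1 B) //= eqxx big1 ?addr0 // => A /andP[_ /negPf->].
by rewrite mul0r.
Qed.


End BasisCone.

(** * Lattice points of the dilated polytope as finite functions *)

Section LatticePoints.
Variables (R : realType) (n : nat).
Implicit Types (M : matroid 'I_n) (t : nat).

Lemma sum_delta_mxE (B : {set 'I_n}) j :
  (\sum_(i in B) delta_mx 0 i : 'rV[R]_n) 0 j = indicator B j.
Proof.
rewrite summxE /indicator; case: (boolP (j \in B)) => jB.
  rewrite (bigD1 j) //= big1 => [|i /andP[_ /negPf neij]].
    by rewrite mxE !eqxx addr0.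
  by rewrite mxE eqxx eq_sym neij.
rewrite big1 // => i iB; rewrite mxE eqxx /=.
by case: eqP => // ji; rewrite ji iB in jB.
Qed.

(** The cone decomposition of [z] has weights of total [t]; dividing them by [t] gives a convex
    combination of bases. *)
Lemma dilated_lattice_points_cone M t (z : 'rV[int]_n) :
  paving M -> dilated_lattice_points R M t z <->
  basis_cone M (fun j => (z 0 j)%:~R : R) t%:R.
Proof.
move=> pavM; split.
  move=> [x [k [a [v [a0 a1 vB ->]]]] eqz].
  have /fin_all_exists[B BE] : forall l, exists B : {set 'I_n},
      B \in bases M /\ \sum_(i in B) delta_mx 0 i = v l.
    by move=> l; have [B bB vE] := vB l; exists B.
  have := basis_cone_sum (M := M) (P := predT) (a := fun l => t%:R * a l) (B := B).
  rewrite -mulr_sumr a1 mulr1 => h.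
  have -> : (fun j => (z 0 j)%:~R : R) =
      (fun i => \sum_l t%:R * a l * indicator (B l) i).
    apply/funext => j.
    have /rowP/(_ j) := eqz; rewrite !mxE => <-.
    rewrite summxE mulr_sumr; apply: eq_bigr => l _.
    by rewrite mxE -(proj2 (BE l)) sum_delta_mxE mulrA.
  apply: h => l _; first by rewrite mulr_ge0 ?ler0n.
  by have [] := BE l.
(* For [t = 0] no division is possible: [z] is the origin, witnessed by any basis vertex scaled by
   [0]. *)
move=> cz; case: t => [|t] in cz *.
  have z0 : z = 0.
    have [_ sl] := cz; apply/rowP => j; rewrite mxE; apply/eqP.
    rewrite -(intr_eq0 R) eq_le (sl (Some (inl (inl j)))) andbT.
    by have := sl (Some (inl (inr j))); rewrite /= sub0r oppr_ge0.
  have [B bB] := bases_neq0 M; pose v : 'rV[R]_n := \sum_(i in B) delta_mx 0 i.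
  exists v; last by rewrite scale0r z0 map_mx0.
  exists 1%N, (fun=> 1), (fun=> v); rewrite !big_ord1 scale1r; split=> // _.
  by exists B.
have [a [a0 a1 za]] := basis_coneP pavM cz.
pose v (B : {set 'I_n}) : 'rV[R]_n := \sum_(i in B) delta_mx 0 i.
have t_neq0 : t.+1%:R != 0 :> R by rewrite pnatr_eq0.
exists (\sum_(B in bases M) (a B / t.+1%:R) *: v B).
  exists #|bases M|, (fun l => a (enum_val l) / t.+1%:R), (fun l => v (enum_val l)).
  split.
  - by move=> l; rewrite divr_ge0 ?ler0n.
  - by rewrite -(big_enum_val (fun B => a B / t.+1%:R)) -mulr_suml a1 divff.
  - by move=> l; exists (enum_val l) => //; exact: enum_valP.
  - exact: (big_enum_val (fun B => (a B / t.+1%:R) *: v B)).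
apply/rowP => j; rewrite !mxE za summxE mulr_sumr; apply: eq_bigr => B _.
by rewrite mxE sum_delta_mxE mulrA mulrCA mulfV ?mulr1.
Qed.

(** The value type ['I_t.+1] builds in the bounds [0 <= z <= t] and makes the points countable. *)
Definition slices (r t : nat) : {set {ffun 'I_n -> 'I_t.+1}} :=
  [set g : {ffun 'I_n -> 'I_t.+1} | \sum_i g i == t * r]%N.

Definition lattice_ffuns M t : {set {ffun 'I_n -> 'I_t.+1}} :=
  [set g in slices (mrank M) t | [forall (H | H \in hyperplanes M),
     \sum_(i in H) g i <= t * (mrank M).-1]]%N.

Definition row_of_ffun t (g : {ffun 'I_n -> 'I_t.+1}) : 'rV[int]_n :=
  \row_j (g j : nat)%:Z.

Lemma row_of_ffun_inj t : injective (@row_of_ffun t).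
Proof.
move=> g h /rowP gh; apply/ffunP => j; apply/val_inj.
by have := gh j; rewrite !mxE => -[].
Qed.

Lemma basis_cone_row_of_ffun M t (g : {ffun 'I_n -> 'I_t.+1}) :
  basis_cone M (fun j => (row_of_ffun g 0 j)%:~R : R) t%:R <->
  g \in lattice_ffuns M t.
Proof.
have gE (A : {set 'I_n}) :
    \sum_(i in A) (row_of_ffun g 0 i)%:~R = (\sum_(i in A) g i)%:R :> R.
  by rewrite natr_sum; apply: eq_bigr => i _; rewrite mxE.
have gT : \sum_i (row_of_ffun g 0 i)%:~R = (\sum_i g i)%:R :> R.
  by rewrite natr_sum; apply: eq_bigr => i _; rewrite mxE.
rewrite inE /basis_cone gT -natrM; split=> [[/eqP sg sl]|/andP[]].
  rewrite inE -(eqr_nat R) sg; apply/forall_inP => H hH.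
  by have := sl (Some (inr H)); rewrite /= hH gE -natrM subr_ge0 ler_nat.
rewrite inE => /eqP -> /forall_inP leH; split=> // -[[[j|j]|H]|] /=.
- by rewrite mxE ler0n.
- by rewrite mxE subr_ge0 ler_nat -ltnS.
- by case: ifP => // /leH; rewrite gE -natrM subr_ge0 ler_nat.
- by rewrite ler0n.
Qed.

(** Since coordinates lie between [0] and [t], every lattice point comes from a unique function
    through [row_of_ffun]. *)
Lemma ehr_lattice_ffuns M t : paving M -> ehr R M t = #|lattice_ffuns M t|.
Proof.
move=> pavM; pose L := [fset g in lattice_ffuns M t]%fset.
have -> : ehr R M t = #|` (@row_of_ffun t @` L)%fset|.
  rewrite /ehr -[X in _ = #|` X|]set_fsetK; congr (#|` fset_set _|).
  apply/seteqP; split=> z.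
    move=> /(dilated_lattice_points_cone _ _ pavM) cz.
    have [_ sl] := cz.
    have z0 j : 0 <= z 0 j by rewrite -(ler_int R) (sl (Some (inl (inl j)))).
    have zt j : (absz (z 0%R j) < t.+1)%N.
      rewrite ltnS -lez_nat gez0_abs // -(ler_int R).
      by have := sl (Some (inl (inr j))); rewrite subr_ge0.
    pose g := [ffun j => Ordinal (zt j)].
    have zE : z = row_of_ffun g.
      by apply/rowP => j; rewrite mxE ffunE /= gez0_abs.
    rewrite zE /=; apply/imfsetP; exists g => //=.
    by rewrite in_fsetE; apply/basis_cone_row_of_ffun; rewrite -zE.
  move=> /= /imfsetP[g /=]; rewrite in_fsetE => gL ->.
  by apply/dilated_lattice_points_cone => //; apply/basis_cone_row_of_ffun.
rewrite card_imfset /=; last exact: row_of_ffun_inj.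
by rewrite -(card_finset (mem (lattice_ffuns M t))).
Qed.

End LatticePoints.

(** * Coefficients of powers of [1 + X + ... + X^t] *)

Section BoxGenerating.
Variable R : comNzRingType.
Implicit Types (P Q : {poly R}).

Definition box_poly t : {poly R} := \sum_(k < t.+1) 'X^k.

(** This is multiplication by the series inverse to [(1 - X)^(s+1)], without power series. Removing
    one factor [1 - X] is a partial summation, and Pascal's rule updates the binomials. *)
Lemma coef_geometric_inv s P Q : (1 - 'X) ^+ s.+1 * Q = P ->
  forall k, Q`_k = \sum_(j < k.+1) P`_j * 'C(k - j + s, s)%:R.
Proof.
elim: s Q P => [|s IHs] Q P.
  rewrite expr1 => <-; elim=> [|k IHk].
    by rewrite big_ord1 mulr1 mulrBl mul1r coefB coefXM subr0.
  rewrite big_ord_recr /= bin0 mulr1 mulrBl mul1r coefB coefXM /=.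
  rewrite [X in X + _](_ : _ = Q`_k) ?subrKC //.
  rewrite IHk; apply: eq_bigr => j _.
  by rewrite !bin0 mulrBl mul1r.
rewrite exprSr -mulrA => /IHs{}IHs; elim=> [|k IHk].
  have := IHs 0; rewrite !big_ord1 mulrBl mul1r coefB coefXM subr0 /=.
  by rewrite subn0 !add0n !binn.
have := IHs k.+1; rewrite mulrBl mul1r coefB coefXM /= => /eqP.
rewrite subr_eq => /eqP ->; rewrite IHk.
rewrite big_ord_recr [RHS]big_ord_recr /= subnn !add0n !binn.
rewrite addrAC; congr (_ + _); rewrite -big_split; apply: eq_bigr => j _ /=.
rewrite -mulrDr -natrD; congr (_ * _%:R).
by rewrite subSn ?leq_ord // !addnS addSn [RHS]binS addnC.
Qed.

(** Multiplying by [(1 - X)^(s+1)] gives [(1 - X^(t+1))^(s+1)], which is expanded by the binomial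
    theorem and divided back. *)
Lemma coef_box_polyX s t k : (box_poly t ^+ s.+1)`_k =
  \sum_(i < s.+2 | (t.+1 * i <= k)%N)
     (-1) ^+ i * 'C(s.+1, i)%:R * 'C(k - t.+1 * i + s, s)%:R.
Proof.
have qE : (1 - 'X) ^+ s.+1 * box_poly t ^+ s.+1 = (1 - 'X^(t.+1)) ^+ s.+1.
  rewrite -exprMn; congr (_ ^+ _).
  by apply: oppr_inj; rewrite -mulNr !opprB subrX1.
rewrite (coef_geometric_inv qE).
have PE j : ((1 - 'X^(t.+1)) ^+ s.+1 : {poly R})`_j =
    \sum_(i < s.+2) (-1) ^+ i * 'C(s.+1, i)%:R * (j == t.+1 * i)%N%:R.
  rewrite exprDn coef_sum; apply: eq_bigr => i _.
  rewrite expr1n mul1r [(- 'X^_) ^+ _]exprNn -exprM coefMn.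
  have -> : (-1 : {poly R}) ^+ i = ((-1) ^+ i)%:P.
    by rewrite rmorphXn rmorphN1.
  by rewrite coefCM coefXn -[LHS]mulr_natr mulrAC.
under eq_bigr do rewrite PE mulr_suml.
rewrite exchange_big [RHS]big_mkcond /=; apply: eq_bigr => i _.
case: leqP => [le|lt].
  rewrite (bigD1 (Ordinal (le : t.+1 * i < k.+1)%N)) //= eqxx mulr1.
  rewrite big1 ?addr0 // => j; rewrite -val_eqE /= => /negPf->.
  by rewrite mulr0 mul0r.
rewrite big1 // => j _; case: eqP => [je|_]; last by rewrite mulr0 mul0r.
by have := ltn_ord j; rewrite je ltnS leqNgt lt.
Qed.

(** Only the term [i = 0] survives: in degree at most [t] the bound on each exponent is never
    reached. *)
Lemma coef_box_polyX_low p t k : (0 < p)%N -> (k <= t)%N ->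
  (box_poly t ^+ p)`_k = 'C(k + p - 1, k)%:R.
Proof.
case: p => // s _ kt; rewrite coef_box_polyX big_mkcond big_ord_recl /=.
rewrite muln0 /= expr0 bin0 !mul1r subn0 big1 ?addr0.
  by rewrite addnS subn1 /= -[in RHS]bin_sub ?leq_addr // addKn.
move=> i _; case: ifP => // h.
have : (t.+1 <= k)%N by apply: leq_trans h; rewrite leq_pmulr.
by rewrite ltnNge kt.
Qed.

(** For [i > s - r] the shift [(t + 1) i] exceeds the degree because [m < t]; for smaller [i], a
    term whose shift exceeds the degree has a vanishing binomial. *)
Lemma coef_box_polyX_slice s r t m : (0 < r)%N -> (r <= s)%N -> (m < t)%N ->
  (box_poly t ^+ s)`_(t * (s - r) + m) = \sum_(0 <= i < (s - r).+1)
     (-1) ^+ i * 'C(s, i)%:R * 'C(t * (s - r - i) + m + s - 1 - i, s - 1)%:R.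
Proof.
case: s => [|s]; first by case: r.
move=> r0 rs mt; rewrite coef_box_polyX.
pose f i : R := if (t.+1 * i <= t * (s.+1 - r) + m)%N then
  (-1) ^+ i * 'C(s.+1, i)%:R * 'C(t * (s.+1 - r) + m - t.+1 * i + s, s)%:R else 0.
rewrite big_mkcond -(big_mkord predT f) /=.
rewrite (big_cat_nat (n := (s.+1 - r).+1)) //=; last by rewrite ltnS leq_subr.
rewrite [X in _ + X]big_nat_cond [X in _ + X]big1 ?addr0; last first.
  move=> i /andP[/andP[lei _] _]; rewrite /f ifF //; apply/negbTE.
  have : (t * (s.+1 - r).+1 <= t * i)%N by rewrite leq_mul2l lei orbT.
  by rewrite mulSn mulnS; clear f; move: (s.+1 - r)%N lei => d; lia.
apply: eq_big_nat => i /andP[_]; rewrite ltnS => ile; rewrite /f.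
have tE : (t * (s.+1 - r) = t * (s.+1 - r - i) + t * i)%N.
  by rewrite -mulnDr subnK.
(* This follows from [0 < r] and keeps the truncated subtraction exact; a spurious ['C(0, 0) = 1]
   could otherwise appear when [s = 0]. *)
have i_le_s : (i <= s)%N by lia.
rewrite tE mulSn; move: (t * _)%N (t * _)%N => x y.
case: leqP => [le|lt]; first by congr (_ * 'C(_, _)%:R); lia.
by rewrite [X in _ * X%:R]bin_small ?mulr0 //; lia.
Qed.

End BoxGenerating.

(* Both sides are the coefficient of [X^a Y^b] in a product of one [box_poly]
   per index, in [X] (reversed) on [A] and in [Y] off [A]. *)
Lemma card_box_slice (I : finType) (A : {set I}) t a b :
  #|[set g : {ffun I -> 'I_t.+1} | (\sum_(i in A) (t - g i) == a)%N &&
       (\sum_(i in ~: A) g i == b)%N]|%:Z =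
  (box_poly int t ^+ #|A|)`_a * (box_poly int t ^+ #|~: A|)`_b.
Proof.
pose F i (k : 'I_t.+1) : {poly {poly int}} :=
  if i \in A then ('X^(t - k))%:P else 'X^k.
have : \prod_i \sum_k F i k = \sum_(g : {ffun I -> 'I_t.+1}) \prod_i F i (g i).
  exact: bigA_distr_bigA.
have -> : \prod_i \sum_k F i k =
    (box_poly int t ^+ #|A|)%:P * map_poly polyC (box_poly int t ^+ #|~: A|).
  rewrite (bigID (mem A)) /=; congr (_ * _).
    rewrite rmorphXn /= -prodr_const; apply: eq_bigr => i iA.
    rewrite rmorph_sum /= (reindex_inj rev_ord_inj) /=; apply: eq_bigr => k _.
    by rewrite /F iA /= subSS subKn // -ltnS.
  rewrite rmorphXn /= -prodr_const; apply: eq_big => i; first by rewrite inE.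
  move=> /negPf iA; rewrite rmorph_sum /=; apply: eq_bigr => k _.
  by rewrite /F iA map_polyXn.
have -> : \sum_(g : {ffun I -> 'I_t.+1}) \prod_i F i (g i) =
    \sum_(g : {ffun I -> 'I_t.+1})
       ('X^(\sum_(i in A) (t - g i)%N))%:P * 'X^(\sum_(i in ~: A) g i).
  apply: eq_bigr => g _; rewrite (bigID (mem A)) /=; congr (_ * _).
    rewrite expr_sum rmorph_prod; apply: eq_bigr => i iA.
    by rewrite /F iA.
  rewrite expr_sum; apply: eq_big => i; first by rewrite inE.
  by move=> /negPf iA; rewrite /F iA.
move=> /(congr1 (fun p : {poly {poly int}} => p`_b`_a)).
rewrite coefCM coef_map /= coefMC => ->.
rewrite !coef_sum -sum1_card -natz natr_sum big_mkcond /=.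
apply: eq_bigr => g _; rewrite coefCM coefXn mulr_natr coefMn coefXn inE.
by rewrite [a == _]eq_sym [b == _]eq_sym; do 2!case: eqP.
Qed.

(** * Counting the points that violate a hyperplane inequality *)

Section Violators.
Variables (n : nat) (t : nat).
Implicit Types (M : matroid 'I_n) (H : {set 'I_n}) (r : nat).

Definition violators r H : {set {ffun 'I_n -> 'I_t.+1}} :=
  [set g in slices n r t | t * r.-1 < \sum_(i in H) g i]%N.

Lemma sum_ffun_leq (g : {ffun 'I_n -> 'I_t.+1}) H :
  (\sum_(i in H) g i <= t * #|H|)%N.
Proof.
by rewrite mulnC -sum_nat_const; apply: leq_sum => i _; rewrite -ltnS.
Qed.

Lemma violators_eq0 r H : (#|H| < r)%N -> violators r H = set0.
Proof.
move=> ltHr; apply/setP => g; rewrite !inE; apply/negbTE; rewrite negb_and.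
rewrite -leqNgt (leq_trans (sum_ffun_leq g H)) ?orbT // leq_mul2l.
by rewrite -ltnS (leq_trans ltHr) ?leqSpred ?orbT.
Qed.

(** Here [m] is the sum off [H]: with total [t r], the sum on [H] exceeds [t (r - 1)] exactly when
    [m < t], and its reflection is [t #|H| - (t r - m)]. *)
Lemma card_violators r H : (0 < r)%N -> (r <= #|H|)%N ->
  #|violators r H| = (\sum_(0 <= m < t)
    #|[set g : {ffun 'I_n -> 'I_t.+1} |
        (\sum_(i in H) (t - g i) == t * (#|H| - r) + m) &&
        (\sum_(i in ~: H) g i == m)]|)%N.
Proof.
move=> r0 rH; rewrite -sum1_card big_mkord.
under [RHS]eq_bigr do rewrite -sum1_card big_mkcond.
rewrite exchange_big big_mkcond /=; apply: eq_bigr => g _.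
under [RHS]eq_bigr do rewrite inE.
have sH : (\sum_(i in H) (t - g i) + \sum_(i in H) g i = t * #|H|)%N.
  rewrite -big_split mulnC -sum_nat_const; apply: eq_bigr => i _ /=.
  by rewrite subnK // -ltnS.
have sT : (\sum_i g i = \sum_(i in H) g i + \sum_(i in ~: H) g i)%N.
  rewrite (bigID (mem H)) /=; congr (_ + _)%N.
  by apply: eq_bigl => i; rewrite inE.
rewrite !inE sT.
move: (\sum_(i in H) g i)%N (\sum_(i in ~: H) g i)%N (\sum_(i in H) _)%N sH.
move=> h b a ah; move: ah.
have -> : (t * #|H| = t * (#|H| - r) + t * r)%N by rewrite -mulnDr subnK.
have -> : (t * r = t * r.-1 + t)%N by rewrite -mulnSr prednK.
move: (t * r.-1)%N (t * _)%N => x y ah.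
have [bt|tb] := ltnP b t; last first.
  rewrite ifF; last by lia.
  rewrite big1 // => m _; rewrite ifF //; have := ltn_ord m; lia.
rewrite (bigD1 (Ordinal bt)) //= big1 ?addn0; first by congr (if _ then _ else _); lia.
move=> m; rewrite -val_eqE /= eq_sym => /negPf->; by rewrite andbF.
Qed.

Lemma disjoint_violators M H H' : paving M ->
  H \in hyperplanes M -> H' \in hyperplanes M -> H != H' ->
  [disjoint violators (mrank M) H & violators (mrank M) H'].
Proof.
move=> pavM hH hH' neH; apply/pred0P => g /=; apply/negbTE; rewrite !inE.
have := paving_card_hyperplaneI pavM hH hH' neH.
have := sum_ffun_leq g (H :&: H').
have sU : (\sum_(i in H) g i + \sum_(i in H') g i =
    \sum_(i in H :|: H') g i + \sum_(i in H :&: H') g i)%N.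
  rewrite [X in (_ + X)%N](big_setID H) [X in (_ = X + _)%N](big_setID H) /=.
  by rewrite setUK setDUl setDv set0U (setIC H') (addnC (\sum_(i in _ :&: _) _)) addnA.
have leT : (\sum_(i in H :|: H') g i <= \sum_i g i)%N.
  by rewrite [X in (_ <= X)%N](bigID (mem (H :|: H'))) leq_addr.
(* From here [r] is the rank of [H], one less than that of [M]. Two violations total more than
   [2 t r], but union and intersection carry at most [t (r + 1) + t (r - 1)]. *)
rewrite -(hyperplane_rk hH) /=; set r := rk M H => le1 le2.
have le3 : (t * #|H :&: H'| + t <= t * r)%N by rewrite -mulnSr leq_mul2l -ltnS le2 orbT.
rewrite mulnS; move: sU leT le1 le3.
move: (\sum_(i in H) _)%N (\sum_(i in H') _)%N => h h'.
move: (\sum_(i in H :|: H') _)%N (\sum_(i in H :&: H') _)%N => u k.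
by move: (\sum_i _)%N (t * r)%N (t * _)%N => s x y; lia.
Qed.

Lemma card_lattice_ffuns M : paving M ->
  #|slices n (mrank M) t| =
  (#|lattice_ffuns M t| + \sum_(H in hyperplanes M) #|violators (mrank M) H|)%N.
Proof.
move=> pavM; rewrite -(cardsID (lattice_ffuns M t)); congr (_ + _)%N.
  by apply: eq_card => g; rewrite !inE; case: (_ == _).
(* The value [set0] off the hyperplanes makes the family disjoint over all pairs of distinct
   sets. *)
pose V H := if H \in hyperplanes M then violators (mrank M) H else set0.
have disjV H H' : H != H' -> [disjoint V H & V H'].
  rewrite /V; case: ifP => [hH|_]; case: ifP => [hH'|_] neH;
    try by rewrite -setI_eq0 ?set0I ?setI0.
  exact: disjoint_violators.
transitivity #|\bigcup_H V H|.
  apply: eq_card => g; rewrite !inE.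
  apply/andP/bigcupP => [[+ sg]|[H _]].
    rewrite sg /= => /forall_inPn[H hH]; rewrite -ltnNge => lt.
    by exists H; rewrite // /V hH !inE sg.
  rewrite /V; case: ifP => hH; rewrite !inE // => /andP[sg lt].
  split=> //; rewrite sg; apply/forall_inPn; exists H => //.
  by rewrite -ltnNge.
rewrite -sum1_card (partition_disjoint_bigcup addn (fun=> 1%N) disjV) [RHS]big_mkcond.
apply: eq_bigr => H _; rewrite sum1_card /V; case: ifP => // _.
by rewrite cards0.
Qed.

(** For each [m] the count is a product of two coefficients. The one for the complement of [H],
    nonempty as [#|H| < n], is in low degree because [m < t]. *)
Lemma card_violators_binomial r H : (0 < r)%N -> (r <= #|H|)%N -> (#|H| < n)%N ->
  #|violators r H|%:Z = \sum_(0 <= m < t) \sum_(0 <= i < (#|H| - r).+1)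
           (-1) ^+ i * 'C(#|H|, i)%:Z
           * 'C(t * (#|H| - r - i) + m + #|H| - 1 - i, #|H| - 1)%:Z
           * 'C(m + n - #|H| - 1, m)%:Z.
Proof.
move=> r0 rH Hn; rewrite card_violators // -natz natr_sum.
apply: eq_big_nat => m /andP[_ mt]; rewrite natz card_box_slice.
have cC : #|~: H| = (n - #|H|)%N.
  by have := cardsC H; rewrite card_ord; lia.
rewrite coef_box_polyX_slice // cC coef_box_polyX_low ?subn_gt0 ?(ltnW mt) //.
rewrite mulr_suml; apply: eq_bigr => i _; rewrite !natz.
by rewrite addnBA // ltnW.
Qed.

End Violators.

(** * The uniform matroid as a paving matroid *)

Section UniformMatroid.
Variables r n : nat.
Hypothesis rn : (r <= n)%N.

Lemma mrank_uniform : mrank (uniform r n) = r.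
Proof.
have [B bB] := bases_neq0 (uniform r n).
have := bB; rewrite bases_uniform // inE => /eqP cB.
by move: bB; rewrite basesE => /andP[_ /eqP <-].
Qed.

Lemma paving_uniform : paving (uniform r n).
Proof.
move=> C; rewrite inE mrank_uniform => /minsetP[].
by rewrite inE -ltnNge => /ltnW.
Qed.

Lemma card_hyperplane_uniform H :
  H \in hyperplanes (uniform r n) -> (#|H| < r)%N.
Proof.
move=> hH; rewrite ltnNge; apply/negP => rH.
have := hyperplane_rk hH; rewrite mrank_uniform => rkH.
have [I [_ _ sIH cI]] := indep_extend (indep0 (uniform r n)) (sub0set H).
have /subsetPn[e eH eI] : ~~ (H \subset I).
  by apply/negP => /subset_leq_card; rewrite cI leqNgt rkH rH.
have cU : #|e |: I| = r by rewrite cardsU1 eI cI add1n.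
have : (#|e |: I| <= rk (uniform r n) H)%N.
  by rewrite indep_leq_rk ?inE ?cU // subUset sub1set eH.
by rewrite cU leqNgt rkH leqnn.
Qed.

(** The paving count has no correction here: hyperplanes with fewer than [r] elements have no
    violators. *)
Lemma lattice_ffuns_uniform t : #|lattice_ffuns (uniform r n) t| = #|slices n r t|.
Proof.
have := card_lattice_ffuns t paving_uniform; rewrite mrank_uniform => ->.
by rewrite big1 ?addn0 // => H /card_hyperplane_uniform/violators_eq0->; rewrite cards0.
Qed.

End UniformMatroid.

(** * Assembly of the formula, grouping hyperplanes by size *)

Theorem theorem5p9 (R : realType) (n r : nat) (M : matroid 'I_n)
    (rkM : mrank M = r) (pavM : paving M) (t : nat) :
  (ehr R M t)%:Z =
    (ehr R (uniform r n) t)%:Z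
    - \sum_(r <= s < n)
        #|hyperplanes_of_card M s|%:Z *
        (\sum_(0 <= m < t) \sum_(0 <= i < (s - r).+1)
           (-1) ^+ i * 'C(s, i)%:Z
           * 'C(t * (s - r - i) + m + s - 1 - i, s - 1)%:Z
           * 'C(m + n - s - 1, m)%:Z).
Proof.
have rn : (r <= n)%N by have := leq_rk_card M [set: 'I_n]; rewrite cardsT card_ord -rkM.
rewrite !ehr_lattice_ffuns //; last exact: paving_uniform.
rewrite lattice_ffuns_uniform // -rkM card_lattice_ffuns // rkM PoszD.
rewrite -[LHS]addr0 -addrA; congr (_ + _); apply/esym/eqP.
rewrite subr_eq0 -natz natr_sum; apply/eqP.
have ltHn H : H \in hyperplanes M -> (#|H| < n)%N.
  by move=> /hyperplane_proper/proper_card; rewrite cardsT card_ord.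
(* Hyperplanes with fewer than [r] elements have no violators, so the sizes start at [r]. *)
rewrite (bigID (fun H : {set 'I_n} => r <= #|H|)%N) /=.
rewrite [X in _ + X]big1 ?addr0; last first.
  by move=> H /andP[_]; rewrite -ltnNge => /violators_eq0->; rewrite cards0.
(* A one-term sum over [s = #|H|] is inserted so that exchanging the sums groups hyperplanes by
   size. *)
transitivity (\sum_(H in hyperplanes M | (r <= #|H|)%N)
    \sum_(r <= s < n | s == #|H|) #|violators t r H|%:Z).
  apply: eq_bigr => H /andP[hH rH].
  by rewrite big_nat1_eq rH ltHn ?natz.
rewrite (exchange_big_dep predT) //=; apply: eq_big_nat => s /andP[rs sn].
under eq_bigr => H /andP[/andP[hH rH] /eqP sH].
  (* The presence of a hyperplane makes the rank positive, so rank [0] needs no separate case. *)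
  rewrite card_violators_binomial ?ltHn //; last by rewrite -rkM -(hyperplane_rk hH).
  rewrite -sH; over.
rewrite sumr_const -mulr_natl natz; congr (Posz _ * _); apply: eq_card => H.
rewrite unfold_in /= [RHS]inE -andbA eq_sym; congr (_ && _).
by case: eqP => [->|_]; rewrite ?rs ?andbF.
Qed.
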